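(* After a suitable rotation, the truncated cube in $\mathbb{R}^3$ can be decomposed into two decahedra (convex polytopes with exactly 10 faces) with orthogonally connected boundaries.
   Context: A polygonal path in $\mathbb{R}^3$ is orthogonal if each of its edges is parallel to one of the coordinate axes. A set $S\subset\mathbb{R}^3$ is orthogonally connected if any two distinct points of $S$ are joined by an orthogonal path contained in $S$. A polytope is decomposed into polytopes $P_1,\dots,P_k$ if it is their union and their interiors are pairwise disjoint. Faces are the 2-dimensional faces. ''After a suitable rotation'' means that there is a rotation of $\mathbb{R}^3$ such that the image of the polytope has the stated property with respect to the fixed coordinate axes. The truncated cube is the Archimedean solid which is, up to similarity, the convex hull of all permutations of $(\pm(\sqrt2-1),\pm1,\pm1)$ (8 triangular and 6 regular octagonal faces). *)

(* Defs.v *)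
From HB Require Import structures.
From mathcomp Require Import all_boot all_order all_algebra.
From mathcomp Require Import all_classical all_reals all_analysis.

Set Implicit Arguments.
Unset Strict Implicit.
Unset Printing Implicit Defensive.

Import Order.TTheory GRing.Theory Num.Theory.
Import numFieldNormedType.Exports.

Local Open Scope classical_set_scope.
Local Open Scope ring_scope.

(* Points of R^n are row vectors 'rV[R]_n; matrices act on the right. *)

Definition convex_hull (R : realType) (n : nat) (V : set 'rV[R]_n) :
    set 'rV[R]_n :=
  smallest (@convex_set R 'rV[R]_n) V.

Definition polytope (R : realType) (n : nat) (P : set 'rV[R]_n) : Prop :=
  exists2 V : set 'rV[R]_n, finite_set V & P = convex_hull V.

Definition boundary (R : realType) (n : nat) (S : set 'rV[R]_n) :
    set 'rV[R]_n :=
  closure S `\` interior S.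

Definition affinely_independent (R : realType) (n d : nat)
    (v : 'I_d.+1 -> 'rV[R]_n) : Prop :=
  row_free (\matrix_(i < d) (v (lift ord0 i) - v ord0)).

Definition has_affine_points (R : realType) (n : nat) (S : set 'rV[R]_n)
    (d : nat) : Prop :=
  exists2 v : 'I_d.+1 -> 'rV[R]_n, forall i, S (v i) & affinely_independent v.

Definition has_dimension (R : realType) (n : nat) (S : set 'rV[R]_n)
    (d : nat) : Prop :=
  has_affine_points S d /\ ~ has_affine_points S d.+1.

(* Intersection of P with a supporting hyperplane {x | x . a = b}. *)
Definition proper_face (R : realType) (n : nat) (P F : set 'rV[R]_n) : Prop :=
  exists (a : 'cV[R]_n) (b : R),
    [/\ a != 0,
        forall x, P x -> (x *m a) 0 0 <= b
      & F = P `&` [set x | (x *m a) 0 0 = b]].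

Definition faces2 (R : realType) (P : set 'rV[R]_3) : set (set 'rV[R]_3) :=
  [set F | proper_face P F /\ has_dimension F 2].

(* Such a P is automatically 3-dimensional: a polytope contained in a plane
   has at most one 2-dimensional face, namely itself. *)
Definition decahedron (R : realType) (P : set 'rV[R]_3) : Prop :=
  polytope P /\ (faces2 P #= `I_10)%card.

Definition decomposed (R : realType) (n k : nat) (P : set 'rV[R]_n)
    (Q : 'I_k -> set 'rV[R]_n) : Prop :=
  [/\ forall i, polytope (Q i),
      P = \bigcup_i Q i
    & trivIset setT (fun i => interior (Q i))].

Definition closed_segment (R : realType) (n : nat) (x y : 'rV[R]_n) :
    set 'rV[R]_n :=
  [set (1 - t) *: x + t *: y | t in [set t : R | 0 <= t <= 1]].

Definition axis_parallel (R : realType) (n : nat) (x y : 'rV[R]_n) : Prop :=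
  exists i : 'I_n, exists2 t : R, t != 0 & y - x = t *: delta_mx 0 i.

Definition orthogonal_edge_in (R : realType) (n : nat) (S : set 'rV[R]_n) :
    rel 'rV[R]_n :=
  fun x y => `[< axis_parallel x y /\ closed_segment x y `<=` S >].

Definition orthogonally_connected (R : realType) (n : nat)
    (S : set 'rV[R]_n) : Prop :=
  forall x y : 'rV[R]_n, S x -> S y -> x != y ->
    exists2 p : seq 'rV[R]_n, path (orthogonal_edge_in S) x p & last x p = y.

Definition orthogonal_mx (R : realType) (n : nat) (A : 'M[R]_n) : Prop :=
  A *m A^T = 1%:M.

Definition is_rotation (R : realType) (n : nat)
    (f : 'rV[R]_n -> 'rV[R]_n) : Prop :=
  exists A : 'M[R]_n,
    [/\ orthogonal_mx A, \det A = 1 & forall x, f x = x *m A].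

Definition is_similarity (R : realType) (n : nat)
    (f : 'rV[R]_n -> 'rV[R]_n) : Prop :=
  exists (c : R) (A : 'M[R]_n) (t : 'rV[R]_n),
    [/\ 0 < c, orthogonal_mx A & forall x, f x = c *: (x *m A) + t].

(* All permutations of (+-(sqrt 2 - 1), +-1, +-1). *)
Definition truncated_cube_vertices (R : realType) : set 'rV[R]_3 :=
  [set x | exists i : 'I_3, forall j : 'I_3,
     `|x 0 j| = if j == i then Num.sqrt 2 - 1 else 1].

Definition is_truncated_cube (R : realType) (T : set 'rV[R]_3) : Prop :=
  exists2 f : 'rV[R]_3 -> 'rV[R]_3, is_similarity f
    & T = f @` convex_hull (@truncated_cube_vertices R).

(* Main.v *)
Require Import Defs.
From HB Require Import structures.
From mathcomp Require Import all_boot all_order all_algebra.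
From mathcomp Require Import all_classical all_reals all_analysis.
From mathcomp Require Import ring lra.

Import Order.TTheory GRing.Theory Num.Theory.
Import numFieldNormedType.Exports.

Local Open Scope classical_set_scope.
Local Open Scope ring_scope.

(** Why it is true. Take the solid K given by |x|, |y|, |z| <= 1 and
    |x| + |y| + |z| <= 2 + a, where a = sqrt 2 - 1: this is the truncated cube.
    The plane z = 0 meets no triangle and cuts exactly four octagons, so each
    half has one whole octagon, four half octagons, four triangles and the
    square of the cut: ten faces. The upper half is [half_solid] and the lower
    one is its image under x |-> - x.

    For an orthogonally connected boundary each face must be parallel to a
    coordinate axis. Turning K by an eighth of a turn about the z-axis places
    the horizontal diagonals (1, -1, 0) and (1, 1, 0) along the first two axes.
    Each triangle is then parallel to one of these diagonals, the cut half
    octagons are vertical, and the two remaining faces are horizontal. On each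
    half every boundary point can reach the centre of the square: from a
    triangle or from the top octagon one moves inside the face to a half
    octagon, goes vertically to the square, and moves in the square along
    the two diagonals ([joined_origin]).

    To count the faces, each half is presented by ten linear inequalities,
    together with ten points at each of which exactly one of them is tight.
    For such a presentation the 2-dimensional faces are exactly the ten sets
    where one inequality is tight ([faces2_polyhedron]), and they are distinct;
    the boundary is their union ([boundary_polyhedron]). To see that the halves
    and K are the convex hulls of their vertices, they are sliced horizontally
    into octagons ([half_sub_convex], [truncated_cube_halves]).

    An arbitrary truncated cube is x |-> c (x A) + t applied to K, with A
    orthogonal. The rotation is x |-> s x (A^T E), where E is the eighth turn
    and the sign s = det A det E makes the determinant equal to 1. It brings the
    solid to x |-> (c s) (x E) + t' applied to K. Presentations by inequalities
    and convex hulls are transported by affine maps, so everything reduces to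
    the one polytope [half_solid], taken with the factors c s and - c s. *)

Set Implicit Arguments.
Unset Strict Implicit.
Unset Printing Implicit Defensive.

(** * Convex hulls *)

Lemma convex_setP (R : realType) (n : nat) (S : set 'rV[R]_n) :
  @convex_set R 'rV[R]_n S <->
  forall (x y : 'rV[R]_n) (t : R),
    0 <= t <= 1 -> S x -> S y -> S (t *: x + (1 - t) *: y).
Proof.
split=> [cS x y t t01 Sx Sy|cS x y l /set_mem Sx /set_mem Sy].
- have t_itv : Itv.spec (@Itv.num_sem R) (Itv.Real `[0%Z, 1%Z]) t.
    by rewrite /= /Itv.num_sem/= in_itv/= t01 num_real.
  by apply/set_mem; exact: (cS x y (Itv.mk t_itv) (mem_set Sx) (mem_set Sy)).
- apply/mem_set; apply: cS => //.
  by rewrite ge0 le1.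
Qed.

Lemma sub_convex_hull (R : realType) (n : nat) (V : set 'rV[R]_n) :
  V `<=` convex_hull V.
Proof. exact: sub_gen_smallest. Qed.

Lemma convex_hull_convex (R : realType) (n : nat) (V : set 'rV[R]_n) :
  @convex_set R 'rV[R]_n (convex_hull V).
Proof.
apply/convex_setP => x y t t01 Vx Vy A /= [cA VA].
by move/convex_setP: (cA); apply=> //; [exact: Vx|exact: Vy].
Qed.

Lemma convex_hull_min (R : realType) (n : nat) (V S : set 'rV[R]_n) :
  @convex_set R 'rV[R]_n S -> V `<=` S -> convex_hull V `<=` S.
Proof. by move=> cS VS; exact: smallest_sub. Qed.

(** Images and preimages of convex sets under an affine map are convex, which
    gives the two inclusions. *)
Lemma convex_hull_affine (R : realType) (n : nat) (M : 'M[R]_n)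
    (t : 'rV[R]_n) (V : set 'rV[R]_n) :
  (fun x => x *m M + t) @` convex_hull V =
  convex_hull ((fun x => x *m M + t) @` V).
Proof.
have gE (x y : 'rV[R]_n) (l : R) : (l *: x + (1 - l) *: y) *m M + t =
    l *: (x *m M + t) + (1 - l) *: (y *m M + t).
  rewrite mulmxDl -!scalemxAl !scalerDr addrACA -scalerDl.
  by rewrite [l + _]addrC subrK scale1r.
apply/seteqP; split.
- move=> _ [x Vx <-]; move: x Vx; apply: convex_hull_min.
  + apply/convex_setP => x y l l01 Vx Vy; rewrite gE.
    by have /convex_setP := @convex_hull_convex R n ((fun x => x *m M + t) @` V); apply.
  + by move=> x Vx; apply: sub_convex_hull; exists x.
- apply: convex_hull_min; last first.
    by move=> _ [x Vx <-]; exists x => //; exact: sub_convex_hull.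
  apply/convex_setP => _ _ l l01 [x Vx <-] [y Vy <-].
  exists (l *: x + (1 - l) *: y); last exact: gE.
  by have /convex_setP := @convex_hull_convex R n V; apply.
Qed.

(** * Systems of linear inequalities: interior and boundary *)

Local Notation "x ** a" := ((x *m a) 0 0) (at level 40).

Definition polyhedron (R : realType) (n : nat) (I : finType)
    (a : I -> 'cV[R]_n) (b : I -> R) : set 'rV[R]_n :=
  [set x | forall k, x ** a k <= b k].

Definition facet (R : realType) (n : nat) (I : finType)
    (a : I -> 'cV[R]_n) (b : I -> R) (k : I) : set 'rV[R]_n :=
  polyhedron a b `&` [set x | x ** a k = b k].

Lemma dotD (R : realType) (n : nat) (x y : 'rV[R]_n) (a : 'cV[R]_n) :
  (x + y) ** a = x ** a + y ** a.
Proof. by rewrite mulmxDl mxE. Qed.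

Lemma dotB (R : realType) (n : nat) (x y : 'rV[R]_n) (a : 'cV[R]_n) :
  (x - y) ** a = x ** a - y ** a.
Proof. by rewrite mulmxBl !mxE. Qed.

Lemma dotZ (R : realType) (n : nat) (e : R) (x : 'rV[R]_n) (a : 'cV[R]_n) :
  (e *: x) ** a = e * (x ** a).
Proof. by rewrite -scalemxAl mxE. Qed.

Lemma dotZr (R : realType) (n : nat) (e : R) (x : 'rV[R]_n) (a : 'cV[R]_n) :
  x ** (e *: a) = e * (x ** a).
Proof. by rewrite -scalemxAr mxE. Qed.

Lemma dot_tr_gt0 (R : realType) (n : nat) (a : 'cV[R]_n) :
  a != 0 -> 0 < a^T ** a.
Proof.
have E : a^T ** a = \sum_j a j 0 ^+ 2.
  by rewrite mxE; apply: eq_bigr => j _; rewrite mxE expr2.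
move=> a0; rewrite E lt0r sumr_ge0 ?andbT; last by move=> j _; rewrite sqr_ge0.
apply: contraNneq a0 => /psumr_eq0P a0; apply/eqP/colP => j; rewrite mxE.
by apply/eqP; rewrite -sqrf_eq0 a0 // => i _; rewrite sqr_ge0.
Qed.

Lemma dot_continuous (R : realType) (n : nat) (a : 'cV[R]_n) :
  continuous (fun x : 'rV[R]_n => x ** a).
Proof.
rewrite (_ : (fun x => _) = fun x : 'rV[R]_n => \sum_j x 0 j * a j 0); last first.
  by apply/funext => x; rewrite mxE.
apply: continuous_big; first exact: add_continuous.
move=> j _ x; apply: continuousM; [exact: coord_continuous|exact: cst_continuous].
Qed.

Lemma open_halfspaces (R : realType) (n : nat) (I : finType) (C : pred I)
    (a : I -> 'cV[R]_n) (b : I -> R) :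
  open [set x : 'rV[R]_n | forall k, C k -> x ** a k < b k].
Proof.
rewrite openE => x /= xab.
suff : \forall y \near x, forall k, C k -> y ** a k < b k by [].
apply: (@filter_forall _ I (fun k y => C k -> y ** a k < b k) _ (nbhs_filter x)) => k.
have [Ck|nCk] := boolP (C k); last by apply: nearW.
have /filterS : \forall y \near x, y ** a k < b k.
  exact: (cvgr_lt _ (@dot_continuous R n (a k) x)) (xab k Ck).
by apply=> y yab _.
Qed.

Lemma closed_polyhedron (R : realType) (n : nat) (I : finType)
    (a : I -> 'cV[R]_n) (b : I -> R) : closed (polyhedron a b).
Proof.
rewrite (_ : polyhedron a b =
    \bigcap_(k in setT) ((fun x => x ** a k) @^-1` [set r | r <= b k])).
  apply: closed_bigI => k _; apply: closed_comp; last exact: closed_le.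
  by move=> x _; exact: dot_continuous.
by apply/seteqP; split=> [x xP k _|x xP k]; [exact: xP|exact: (xP k Logic.I)].
Qed.

Lemma nbhs_ray (R : realType) (n : nat) (S : set 'rV[R]_n) (x w : 'rV[R]_n) :
  nbhs x S -> \forall e \near 0^'+, S (x + e *: w).
Proof.
move=> xS.
have ray_cvg : (fun e : R => x + e *: w) @ 0^'+ --> x.
  apply: cvg_at_right_filter.
  rewrite [X in _ --> X](_ : x = x + 0 *: w); last by rewrite scale0r addr0.
  by apply: cvgD; [exact: cvg_cst|apply: cvgZr_tmp; exact: cvg_id].
exact: ray_cvg xS.
Qed.

(** From an interior point one can still move in the direction of the outer
    normal, hence no supporting inequality is attained there. *)
Lemma interior_dot_lt (R : realType) (n : nat) (S : set 'rV[R]_n)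
    (a : 'cV[R]_n) (b : R) (x : 'rV[R]_n) :
  a != 0 -> (forall y, S y -> y ** a <= b) -> interior S x -> x ** a < b.
Proof.
move=> a0 Sab /(@nbhs_ray R n S x a^T) near_S.
have [e] : exists e : R, 0 < e /\ S (x + e *: a^T).
  near (0 : R)^'+ => e; exists e; split=> //.
  by near: e.
case=> e0 /Sab; rewrite dotD dotZ; apply: lt_le_trans.
by rewrite ltrDl mulr_gt0 // dot_tr_gt0.
Unshelve. all: by end_near.
Qed.

Lemma interior_polyhedron (R : realType) (n : nat) (I : finType)
    (a : I -> 'cV[R]_n) (b : I -> R) (x : 'rV[R]_n) :
  (forall k, x ** a k < b k) -> interior (polyhedron a b) x.
Proof.
move=> xab.
have : nbhs x [set y : 'rV[R]_n | forall k, predT k -> y ** a k < b k].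
  by apply: open_nbhs_nbhs; split; [exact: open_halfspaces|move=> k _; exact: xab].
by apply: filterS => y yab k; exact/ltW/yab.
Qed.

(** A point where an inequality is tight is not interior by [interior_dot_lt];
    where none is tight, the finitely many strict inequalities persist nearby. *)
Lemma boundary_polyhedron (R : realType) (n : nat) (I : finType)
    (a : I -> 'cV[R]_n) (b : I -> R) : (forall k, a k != 0) ->
  boundary (polyhedron a b) = \bigcup_k facet a b k.
Proof.
move=> a0; rewrite /boundary.
have /closure_id <- := @closed_polyhedron R n I a b.
apply/seteqP; split=> x.
- case=> xP nint; apply: contrapT => nfacet; apply: nint.
  apply: interior_polyhedron => k; rewrite lt_neqAle xP andbT.
  by apply/eqP => xk; apply: nfacet; exists k.
- case=> k _ [xP xk]; split=> // xint.
  have := @interior_dot_lt R n _ (a k) (b k) x (a0 k) (fun y yP => yP k) xint.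
  by rewrite xk ltxx.
Qed.

(** * Two-dimensional faces *)

Lemma mxrank_col_neq0 (F : fieldType) (n : nat) (a : 'cV[F]_n) :
  a != 0 -> \rank a = 1%N.
Proof.
by move=> a0; apply/eqP; rewrite eqn_leq rank_leq_col lt0n mxrank_eq0.
Qed.

(** The differences of the points form a matrix of corank one, whose kernel is
    the line of common normals; so [c] is a multiple of [a]. *)
Lemma affinely_independent_hyperplane (R : realType) (n : nat)
    (v : 'I_n.+1 -> 'rV[R]_n.+1) (a c : 'cV[R]_n.+1) (b d : R) :
  affinely_independent v -> a != 0 -> c != 0 ->
  (forall i, v i ** a = b) -> (forall i, v i ** c = d) ->
  exists2 l : R, l != 0 & c = l *: a /\ d = l * b.
Proof.
rewrite /affinely_independent; set D := \matrix_(i < n) _ => /eqP rkD a0 c0 va vc.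
have D0 (e : 'cV[R]_n.+1) f : (forall i, v i ** e = f) -> (e^T <= kermx D^T)%MS.
  move=> ve; apply/sub_kermxP; rewrite -trmx_mul (_ : D *m e = 0) ?trmx0 //.
  apply/colP => i; rewrite [RHS]mxE.
  have -> : (D *m e) i 0 = row i D ** e by rewrite -row_mul [RHS]mxE.
  by rewrite rowK dotB !ve subrr.
have aK : (kermx D^T <= a^T)%MS.
  rewrite -(mxrank_leqif_sup (D0 _ _ va)) mxrank_ker !mxrank_tr rkD.
  by rewrite mxrank_col_neq0 // subSnn.
have /sub_rVP[l cl] := submx_trans (D0 _ _ vc) aK.
have cla : c = l *: a by apply/trmx_inj; rewrite cl linearZ.
exists l; first by apply: contraNneq c0 => l0; rewrite cla l0 scale0r.
split=> //.
by rewrite -(vc ord0) -(va ord0) cla dotZr.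
Qed.

(** The differences of one point too many would form an invertible matrix that
    annihilates the normal. *)
Lemma hyperplane_affine_points (R : realType) (n : nat) (S : set 'rV[R]_n)
    (a : 'cV[R]_n) (b : R) :
  a != 0 -> (forall x, S x -> x ** a = b) -> ~ has_affine_points S n.
Proof.
move=> a0 Sab [v Sv]; rewrite /affinely_independent.
set D := \matrix_(i < n) _; rewrite row_free_unit => Du.
move/eqP: a0; apply; rewrite -[a](mulKmx Du) (_ : D *m a = 0) ?mulmx0 //.
apply/colP => i; rewrite [RHS]mxE.
have -> : (D *m a) i 0 = row i D ** a by rewrite -row_mul [RHS]mxE.
by rewrite rowK dotB !Sab // subrr.
Qed.

(** The witness [p k] lies in the relative interior of the [k]-th facet; its
    existence says that none of the inequalities is redundant and that no two
    of them are proportional. *)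
Definition facet_witness (R : realType) (n : nat) (I : finType)
    (a : I -> 'cV[R]_n) (b : I -> R) (p : I -> 'rV[R]_n) : Prop :=
  forall k, [/\ a k != 0, p k ** a k = b k &
    forall l, l != k -> p k ** a l < b l].

(** Take the witness and its small displacements along a basis [B] of the
    hyperplane: the strict inequalities at the witness survive them. *)
Lemma facet_affine_points (R : realType) (n : nat) (I : finType)
    (a : I -> 'cV[R]_n.+1) (b : I -> R) (p : I -> 'rV[R]_n.+1) (k : I) :
  facet_witness a b p -> has_affine_points (facet a b k) n.
Proof.
move=> /(_ k)[ak0 pk plt].
have [B freeB Ba] : exists2 B : 'M[R]_(n, n.+1), row_free B & B *m a k = 0.
  have rk : \rank (kermx (a k)) = n by rewrite mxrank_ker mxrank_col_neq0 // subn1.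
  have : exists2 B : 'M[R]_(\rank (kermx (a k)), n.+1),
      row_free B & B *m a k = 0.
    exists (row_base (kermx (a k))); first exact: row_base_free.
    by apply/sub_kermxP; rewrite eq_row_base.
  by rewrite rk.
have [e e0 eP] : exists2 e : R, e != 0 &
    forall i l, l != k -> (p k + e *: row i B) ** a l < b l.
  have near_lt : \forall e \near (0 : R)^'+,
      forall i l, l != k -> (p k + e *: row i B) ** a l < b l.
    have right_filter : Filter (0 : R)^'+ by exact: within_filter.
    apply: (@filter_forall _ _ (fun i e => forall l, l != k ->
      (p k + e *: row i B) ** a l < b l) _ right_filter) => i.
    apply: (@nbhs_ray _ _ [set x | forall l, l != k -> x ** a l < b l]).
    apply: open_nbhs_nbhs; split; last exact: plt.
    exact: open_halfspaces.
  near (0 : R)^'+ => e; exists e; first exact: lt0r_neq0.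
  by near: e.
have rowBa i : row i B ** a k = 0 by rewrite -row_mul Ba !mxE.
pose v (i : 'I_n.+1) := if unlift ord0 i is Some j then p k + e *: row j B else p k.
have vE i : v (lift ord0 i) - v ord0 = e *: row i B.
  by rewrite /v liftK unlift_none addrC addKr.
exists v; last first.
  rewrite /affinely_independent (_ : \matrix_(i < n) _ = e *: B).
    by rewrite /row_free mxrank_scale_nz.
  by apply/row_matrixP => i; rewrite rowK vE linearZ.
have vk i : v i ** a k = b k.
  by rewrite /v; case: unliftP => [j _|_] //; rewrite dotD dotZ rowBa mulr0 addr0.
move=> i; split; last exact: vk.
move=> l; have [->|lk] := eqVneq l k; first by rewrite vk.
by apply: ltW; rewrite /v; case: unliftP => [j _|_]; [exact: eP|exact: plt].
Unshelve. all: by end_near.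
Qed.

Lemma facet_inj (R : realType) (n : nat) (I : finType)
    (a : I -> 'cV[R]_n) (b : I -> R) (p : I -> 'rV[R]_n) :
  facet_witness a b p -> injective (facet a b).
Proof.
move=> w k l kl; apply/eqP/contraT => kNl.
have [_ pk plt] := w k.
have : facet a b l (p k).
  rewrite -kl; split=> // m; have [->|mk] := eqVneq m k; first by rewrite pk.
  exact/ltW/plt.
by case=> _ /= pl; move: (plt l); rewrite eq_sym pl ltxx => /(_ kNl).
Qed.

(** A supporting hyperplane spanned by affinely independent points of the
    polyhedron contains their centroid, which is thus not interior; so some
    defining inequality is tight there, hence at each of these points;
    the two hyperplanes then coincide. *)
Lemma faces2_polyhedron (R : realType) (I : finType)
    (a : I -> 'cV[R]_3) (b : I -> R) (p : I -> 'rV[R]_3) :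
  facet_witness a b p -> faces2 (polyhedron a b) = range (facet a b).
Proof.
move=> w; apply/seteqP; split=> [F|_ [k _ <-]]; last first.
  have [ak0 _ _] := w k; split; first by exists (a k), (b k); split.
  split; first exact: facet_affine_points w.
  by apply: (@hyperplane_affine_points _ _ _ (a k) (b k)) => // x [].
case=> -[c] [d] [c0 Pcd ->{F}] [[v Fv vfree] _].
have vP i : polyhedron a b (v i) by case: (Fv i).
have vc i : v i ** c = d by case: (Fv i).
pose m := 3^-1 *: \sum_i v i.
have mE (e : 'cV[R]_3) : m ** e = 3^-1 * (v 0 ** e + v 1 ** e + v 2 ** e).
  rewrite /m dotZ !big_ord_recr big_ord0 /= add0r !dotD.
  by congr (_ * (v _ ** e + v _ ** e + v _ ** e)); apply/val_inj.
have [k mk] : exists k, ~ m ** a k < b k.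
  apply: contrapT => nk.
  have mint : interior (polyhedron a b) m.
    by apply: interior_polyhedron => k; apply: contrapT => mk; apply: nk; exists k.
  have := interior_dot_lt c0 Pcd mint; rewrite mE !vc.
  by move=> h; lra.
have vk i : v i ** a k = b k.
  move/negP: mk; rewrite -leNgt mE.
  have := vP 0 k; have := vP 1 k; have := vP 2 k.
  have [->|->|->] : [\/ i = 0, i = 1 | i = 2].
  - case: i => -[|[|[|//]]] i3; [apply: Or31|apply: Or32|apply: Or33]; exact/val_inj.
  - by lra.
  - by lra.
  - by lra.
have [ak0 _ _] := w k.
have [l l0 [cl dl]] := affinely_independent_hyperplane vfree ak0 c0 vk vc.
exists k => //; rewrite /facet; congr (_ `&` _).
apply/seteqP; split=> x /=; rewrite cl dl dotZr.
  by move=> ->.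
exact: mulfI.
Qed.

Lemma card_faces2_polyhedron (R : realType) (n : nat)
    (a : 'I_n -> 'cV[R]_3) (b : 'I_n -> R) (p : 'I_n -> 'rV[R]_3) :
  facet_witness a b p -> (faces2 (polyhedron a b) #= `I_n)%card.
Proof.
move=> w; rewrite (faces2_polyhedron w) (card_eqr card_II).
by apply: inj_card_eq => k l _ _; exact: facet_inj w _ _.
Qed.

(** * Affine images of systems of inequalities *)

Section AffineImages.
Variables (R : realType) (n : nat) (I : finType) (M : 'M[R]_n) (t : 'rV[R]_n).
Hypothesis Mu : M \in unitmx.
Variables (a : I -> 'cV[R]_n) (b : I -> R).

Let g (x : 'rV[R]_n) := x *m M + t.
Let ga k := invmx M *m a k.
Let gb k := b k + t ** ga k.

Lemma affine_dot x k : g x ** ga k = x ** a k + t ** ga k.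
Proof. by rewrite dotD -mulmxA mulKVmx. Qed.

Lemma affine_onto y : exists x, y = g x.
Proof. by exists ((y - t) *m invmx M); rewrite /g mulmxKV // subrK. Qed.

Lemma polyhedron_affine : g @` polyhedron a b = polyhedron ga gb.
Proof.
apply/seteqP; split=> [_ [x xP <-] k|y yP].
  by rewrite affine_dot lerD2r.
have [x yE] := affine_onto y; exists x => // k.
by have := yP k; rewrite yE affine_dot lerD2r.
Qed.

Lemma facet_affine k : g @` facet a b k = facet ga gb k.
Proof.
rewrite /facet -polyhedron_affine; apply/seteqP; split.
  move=> _ [x [xP /= xk] <-]; split; first by exists x.
  by rewrite /= affine_dot xk.
move=> _ [[x xP <-]] /=; rewrite affine_dot => /addIr xk.
by exists x.
Qed.

Lemma facet_witness_affine p :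
  facet_witness a b p -> facet_witness ga gb (g \o p).
Proof.
move=> w k; have [ak0 pk plt] := w k; split.
- apply: contraNneq ak0 => gak0.
  by rewrite -[a k](mulKVmx Mu) -/(ga k) gak0 mulmx0.
- by rewrite /= affine_dot pk.
- by move=> l lk; rewrite /= affine_dot ltrD2r plt.
Qed.

End AffineImages.

(** * Orthogonal paths *)

Definition joined (R : realType) (n : nat) (S : set 'rV[R]_n)
    (x y : 'rV[R]_n) : Prop :=
  exists2 p : seq 'rV[R]_n, path (orthogonal_edge_in S) x p & last x p = y.

Lemma joined_refl (R : realType) (n : nat) (S : set 'rV[R]_n) x : joined S x x.
Proof. by exists [::]. Qed.

Lemma joined_trans (R : realType) (n : nat) (S : set 'rV[R]_n) x y z :
  joined S x y -> joined S y z -> joined S x z.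
Proof.
case=> p xp <- [q yq <-]; exists (p ++ q); last by rewrite last_cat.
by rewrite cat_path xp.
Qed.

Lemma closed_segmentC (R : realType) (n : nat) (x y : 'rV[R]_n) :
  closed_segment x y `<=` closed_segment y x.
Proof.
move=> _ [l /= /andP[l0 l1] <-]; exists (1 - l); first by rewrite /=; lra.
by rewrite addrC subKr.
Qed.

Lemma joined_sym (R : realType) (n : nat) (S : set 'rV[R]_n) x y :
  joined S x y -> joined S y x.
Proof.
case=> p + <-; elim/last_ind: p => [|p z IH]; first by move=> _; exists [::].
rewrite rcons_path last_rcons => /andP[/IH pS /asboolP[[i [e e0 eE]] zS]].
apply: (@joined_trans _ _ _ _ (last x p)) => //; exists [:: last x p] => //=.
rewrite andbT; apply/asboolP; split.
  by exists i; exists (- e); rewrite ?oppr_eq0 // scaleNr -eE opprB.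
by apply: subset_trans zS; exact: closed_segmentC.
Qed.

(** The degenerate case [e = 0] is allowed: a path may be empty although its
    edges may not. *)
Lemma joined_axis (R : realType) (n : nat) (S F : set 'rV[R]_n)
    (x y : 'rV[R]_n) (i : 'I_n) (e : R) :
  @convex_set R 'rV[R]_n F -> F `<=` S -> F x -> F y ->
  y - x = e *: delta_mx 0 i -> joined S x y.
Proof.
move=> /convex_setP cF FS Fx Fy xy.
have [e0|e0] := eqVneq e 0.
  move: xy; rewrite e0 scale0r => /eqP; rewrite subr_eq0 => /eqP ->.
  exact: joined_refl.
exists [:: y] => //=; rewrite andbT; apply/asboolP; split.
  by exists i, e.
move=> _ [l /= l01 <-]; apply: FS.
by rewrite addrC; apply: cF.
Qed.

(** Orthogonal paths can be reversed, so it is enough to reach one point [o]. *)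
Lemma joined_to_connected (R : realType) (n : nat) (S : set 'rV[R]_n) o :
  (forall x, S x -> joined S x o) -> orthogonally_connected S.
Proof.
move=> So x y Sx Sy _.
exact: joined_trans (So x Sx) (joined_sym (So y Sy)).
Qed.

Lemma convex_polyhedron (R : realType) (n : nat) (I : finType)
    (a : I -> 'cV[R]_n) (b : I -> R) : @convex_set R 'rV[R]_n (polyhedron a b).
Proof.
apply/convex_setP => x y l /andP[l0 l1] xP yP k.
rewrite dotD !dotZ.
have := xP k; have := yP k; nra.
Qed.

Lemma convex_facet (R : realType) (n : nat) (I : finType)
    (a : I -> 'cV[R]_n) (b : I -> R) k : @convex_set R 'rV[R]_n (facet a b k).
Proof.
have /convex_setP cP := @convex_polyhedron R n I a b.
apply/convex_setP => x y l l01 [xP /= xk] [yP /= yk]; split; first exact: cP.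
by rewrite /= dotD !dotZ xk yk; ring.
Qed.

(** A facet is convex, so the image of the segment from [x] to [y] lies in a
    facet of the image, hence in its boundary. *)
Lemma joined_affine_facet (R : realType) (n : nat) (I : finType)
    (M : 'M[R]_n) (t : 'rV[R]_n) (a : I -> 'cV[R]_n) (b : I -> R)
    (k : I) (x y : 'rV[R]_n) (i : 'I_n) (e : R) :
  M \in unitmx -> (forall k, a k != 0) ->
  facet a b k x -> facet a b k y -> (y - x) *m M = e *: delta_mx 0 i ->
  joined (boundary ((fun x => x *m M + t) @` polyhedron a b))
    (x *m M + t) (y *m M + t).
Proof.
move=> Mu a0 xk yk xy.
rewrite polyhedron_affine // boundary_polyhedron; last first.
  move=> l; apply: contraNneq (a0 l) => al0.
  by rewrite -[a l](mulKVmx Mu) al0 mulmx0.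
have gfacet z : facet a b k z -> facet (fun k => invmx M *m a k)
    (fun k => b k + t ** (invmx M *m a k)) k (z *m M + t).
  by move=> zk; rewrite -facet_affine //; exists z.
apply: (@joined_axis _ _ _ _ _ _ i e _ _ (gfacet x xk) (gfacet y yk)).
- exact: convex_facet.
- by move=> z zk; exists k.
- by rewrite -xy mulmxBl opprD addrACA subrr addr0.
Qed.

(** * The half of the truncated cube as ten inequalities *)

Definition pt (R : realType) (x y z : R) : 'rV[R]_3 := \row_j [:: x; y; z]`_j.

Lemma pt_surj (R : realType) (v : 'rV[R]_3) : exists x y z, v = pt x y z.
Proof.
exists (v 0 0), (v 0 1), (v 0 2).
by apply/rowP => -[[|[|[|//]]] j3]; rewrite mxE /=; congr (v _ _); apply/val_inj.
Qed.

Lemma ptD (R : realType) (x y z x' y' z' : R) :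
  pt x y z + pt x' y' z' = pt (x + x') (y + y') (z + z').
Proof. by apply/rowP => -[[|[|[|//]]] j3]; rewrite !mxE. Qed.

Lemma ptZ (R : realType) (e x y z : R) :
  e *: pt x y z = pt (e * x) (e * y) (e * z).
Proof. by apply/rowP => -[[|[|[|//]]] j3]; rewrite !mxE. Qed.

Lemma pt_dot (R : realType) (x y z u v w : R) :
  pt x y z ** (pt u v w)^T = x * u + y * v + z * w.
Proof. by rewrite mxE !big_ord_recr big_ord0 /= !mxE /= add0r. Qed.

Lemma pt_eq0 (R : realType) (x y z : R) :
  pt x y z = 0 -> [/\ x = 0, y = 0 & z = 0].
Proof.
move=> /rowP xyz; split.
- by have := xyz 0; rewrite !mxE.
- by have := xyz 1; rewrite !mxE.
- by have := xyz 2; rewrite !mxE.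
Qed.

(** In order: the square of the cut, the whole octagon, the four half octagons
    and the four triangles. *)
Definition half_normal (R : realType) (k : 'I_10) : 'cV[R]_3 :=
  (nth 0 [:: pt 0 0 (-1); pt 0 0 1;
             pt 1 0 0; pt (-1) 0 0; pt 0 1 0; pt 0 (-1) 0;
             pt 1 1 1; pt 1 (-1) 1; pt (-1) 1 1; pt (-1) (-1) 1] k)^T.

Definition half_bound (R : realType) (a : R) (k : 'I_10) : R :=
  [:: 0; 1; 1; 1; 1; 1; 2 + a; 2 + a; 2 + a; 2 + a]`_k.

Definition half_solid (R : realType) (a : R) : set 'rV[R]_3 :=
  polyhedron (@half_normal R) (half_bound a).

(** Points in the relative interiors of the faces; for the triangles these are
    the centroids. *)
Definition half_witness (R : realType) (a : R) (k : 'I_10) : 'rV[R]_3 :=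
  let c := (2 + a) / 3 in
  nth 0 [:: pt 0 0 0; pt 0 0 1;
            pt 1 0 2^-1; pt (-1) 0 2^-1; pt 0 1 2^-1; pt 0 (-1) 2^-1;
            pt c c c; pt c (- c) c; pt (- c) c c; pt (- c) (- c) c] k.

Local Notation ord10 k := (@Ordinal 10 k isT).

Lemma ord10_ind (Q : 'I_10 -> Prop) :
  Q (ord10 0) -> Q (ord10 1) -> Q (ord10 2) -> Q (ord10 3) -> Q (ord10 4) ->
  Q (ord10 5) -> Q (ord10 6) -> Q (ord10 7) -> Q (ord10 8) -> Q (ord10 9) ->
  forall k, Q k.
Proof.
move=> Q0 Q1 Q2 Q3 Q4 Q5 Q6 Q7 Q8 Q9 [k k10].
by move: k k10; do 10![case=> [k10|]; first by rewrite (bool_irrelevance k10 isT)].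
Qed.

Lemma half_normal_neq0 (R : realType) (k : 'I_10) : @half_normal R k != 0.
Proof.
rewrite trmx_eq0; apply/eqP.
by elim/ord10_ind: k => /pt_eq0[]; lra.
Qed.

Lemma half_facet_witness (R : realType) (a : R) : 0 < a < 1 ->
  facet_witness (@half_normal R) (half_bound a) (half_witness a).
Proof.
move=> a01 k; split; first exact: half_normal_neq0.
- by elim/ord10_ind: k; rewrite pt_dot /half_bound /=; lra.
- move=> l; elim/ord10_ind: k; elim/ord10_ind: l => // _;
  rewrite pt_dot /half_bound /=; lra.
Qed.

Lemma halfP (R : realType) (a x y z : R) :
  half_solid a (pt x y z) <->
  [/\ 0 <= z <= 1, -1 <= x <= 1, -1 <= y <= 1,
      x + y + z <= 2 + a /\ x - y + z <= 2 + a
    & - x + y + z <= 2 + a /\ - x - y + z <= 2 + a].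
Proof.
split=> [H|[/andP[z0 z1] /andP[x0 x1] /andP[y0 y1] [h6 h7] [h8 h9]]].
- have := (H (ord10 0), (H (ord10 1), H (ord10 2), H (ord10 3)),
    (H (ord10 4), H (ord10 5), H (ord10 6)),
    (H (ord10 7), H (ord10 8), H (ord10 9))).
  rewrite !pt_dot /half_bound /= => -[[[h0 [[h1 h2] h3]] [[h4 h5] h6]] [[h7 h8] h9]].
  by split; [lra|lra|lra|split; lra|split; lra].
- by move=> k; elim/ord10_ind: k; rewrite pt_dot /half_bound /=; lra.
Qed.

(** * The half as a convex hull *)

Definition signs (R : realType) : seq R := [:: 1; -1].

Definition half_vertices (R : realType) (a : R) : seq 'rV[R]_3 :=
  [seq pt s t 0 | s <- signs R, t <- signs R] ++
  [seq pt s t a | s <- signs R, t <- signs R] ++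
  [seq pt s (t * a) 1 | s <- signs R, t <- signs R] ++
  [seq pt (s * a) t 1 | s <- signs R, t <- signs R].

(** Lets the sixteen vertices be treated by their signs. *)
Lemma half_vertices_sub (R : realType) (a : R) (S : set 'rV[R]_3) :
  (forall s t, s \in signs R -> t \in signs R ->
    [/\ S (pt s t 0), S (pt s t a), S (pt s (t * a) 1) & S (pt (s * a) t 1)]) <->
  [set` half_vertices a] `<=` S.
Proof.
rewrite /half_vertices.
(* Abstracting the list of signs prevents its comprehensions from being unfolded. *)
move: (signs R) => sg; split=> [H v|H s t ss ts].
- rewrite [X in X -> _]/mkset !mem_cat => /or4P[] /allpairsP[[s t] /= [ss ts ->]];
  by have [] := H s t ss ts.
- by split; apply: H; rewrite /mkset !mem_cat;
  apply/or4P; [apply: Or41|apply: Or42|apply: Or43|apply: Or44];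
  apply/allpairsP; exists (s, t).
Qed.

Lemma between_convex (R : realType) (u v x : R) : u <= x <= v ->
  exists2 l : R, 0 <= l <= 1 & x = l * u + (1 - l) * v.
Proof.
move=> /andP[ux xv]; have [uv|uv] := eqVneq u v.
  by exists 0; [rewrite lexx ler01|rewrite uv in ux *; lra].
have d0 : 0 < v - u by rewrite subr_gt0 lt_neqAle uv (le_trans ux).
exists ((v - x) / (v - u)); last by field; lra.
by rewrite divr_ge0 ?ler_pdivrMr //=; lra.
Qed.

Section ConvexCoordinates.
Variables (R : realType) (S : set 'rV[R]_3).
Hypothesis cS : @convex_set R 'rV[R]_3 S.

Lemma convex_pt (l x y z x' y' z' : R) : 0 <= l <= 1 ->
  S (pt x y z) -> S (pt x' y' z') ->
  S (pt (l * x + (1 - l) * x') (l * y + (1 - l) * y') (l * z + (1 - l) * z')).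
Proof.
move=> l01 Sp Sq; have /convex_setP := cS.
by move=> /(_ _ _ _ l01 Sp Sq); rewrite !ptZ ptD.
Qed.

Lemma convex_x (u v x y z : R) :
  u <= x <= v -> S (pt u y z) -> S (pt v y z) -> S (pt x y z).
Proof.
move=> /between_convex[l l01 ->] Su Sv.
rewrite (_ : y = l * y + (1 - l) * y); last by ring.
rewrite [X in pt _ _ X](_ : z = l * z + (1 - l) * z); last by ring.
exact: convex_pt.
Qed.

Lemma convex_y (u v x y z : R) :
  u <= y <= v -> S (pt x u z) -> S (pt x v z) -> S (pt x y z).
Proof.
move=> /between_convex[l l01 ->] Su Sv.
rewrite (_ : x = l * x + (1 - l) * x); last by ring.
rewrite [X in pt _ _ X](_ : z = l * z + (1 - l) * z); last by ring.
exact: convex_pt.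
Qed.

Lemma convex_z (u v x y z : R) :
  u <= z <= v -> S (pt x y u) -> S (pt x y v) -> S (pt x y z).
Proof.
move=> /between_convex[l l01 ->] Su Sv.
rewrite (_ : x = l * x + (1 - l) * x); last by ring.
rewrite (_ : y = l * y + (1 - l) * y); last by ring.
exact: convex_pt.
Qed.

End ConvexCoordinates.

(** A point of the octagon lies on a segment parallel to the first axis with
    ends on the sides of the octagon: on the sides [x = +-1] if [|y| <= r], and
    on the oblique ones otherwise. *)
Lemma octagon_sub_convex (R : realType) (S : set 'rV[R]_3) (r x y z : R) :
  @convex_set R 'rV[R]_3 S -> 0 <= r <= 1 ->
  (forall s t, s \in signs R -> t \in signs R ->
    S (pt s (t * r) z) /\ S (pt (s * r) t z)) ->
  `|x| <= 1 -> `|y| <= 1 -> `|x| + `|y| <= 1 + r -> S (pt x y z).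
Proof.
move=> cS r01 Sv x1 y1 xy.
have m1 : 1 \in signs R by rewrite !inE eqxx.
have mN : -1 \in signs R by rewrite !inE eqxx orbT.
have [yr|ry] := leP `|y| r.
  have Ss s : s \in signs R -> S (pt s y z).
    move=> ms; apply: (convex_y cS (u := -1 * r) (v := 1 * r)).
    - by move: yr; rewrite ler_norml; lra.
    - exact: (Sv s (-1) ms mN).1.
    - exact: (Sv s 1 ms m1).1.
  apply: (convex_x cS (u := -1) (v := 1)); rewrite -?ler_norml //; exact: Ss.
have [t [mt yt]] : exists t, t \in signs R /\ y = t * `|y|.
  have [y0|y0] := ger0P y; [exists 1|exists (-1)]; split=> //; lra.
have St s : s \in signs R -> S (pt (s * (1 + r - `|y|)) y z).
  have [l l01 yl] : exists2 l : R, 0 <= l <= 1 & `|y| = l * r + (1 - l) * 1.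
    by apply: between_convex; rewrite (ltW ry).
  move=> ms; have [S1 S2] := Sv s t ms mt.
  have := convex_pt cS l01 S1 S2; congr (S (pt _ _ _)).
  - by rewrite yl; ring.
  - by rewrite [RHS]yt yl; ring.
  - by ring.
apply: (convex_x cS _ (St _ mN) (St _ m1)).
move: x1 xy; rewrite !ler_norml.
by have := ler_norm x; have := ler_norm (- x); rewrite normrN; lra.
Qed.

(** Horizontal sections are squares up to height [a] and octagons above it. The
    vertices of the section at height [z] slide along edges of the half: along
    the vertical ones for [z <= a], along the edges from [(+-1, +-1, a)] to the
    vertices of the top octagon for [z >= a]. *)
Lemma half_sub_convex (R : realType) (a : R) (S : set 'rV[R]_3) :
  0 <= a < 1 -> @convex_set R 'rV[R]_3 S ->
  [set` half_vertices a] `<=` S -> half_solid a `<=` S.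
Proof.
move=> a01 cS /half_vertices_sub Sv v.
have [x [y [z ->]]] := pt_surj v; move/halfP => [z01 x1 y1 [h6 h7] [h8 h9]].
have nx : `|x| <= 1 by rewrite ler_norml.
have ny : `|y| <= 1 by rewrite ler_norml.
have [za|az] := leP z a.
  (* A square is an octagon with [r = 1], where vertices coincide in pairs. *)
  apply: (@octagon_sub_convex R S 1) => //; [lra| |lra].
  move=> s t ms mt; rewrite !mulr1.
  have [S0 Sa _ _] := Sv s t ms mt.
  by split; apply: (convex_z cS _ S0 Sa); lra.
apply: (@octagon_sub_convex R S (1 + a - z)) => //; [lra| |]; last first.
  by case: (ger0P x); case: (ger0P y); lra.
move=> s t ms mt; have [_ Sa S1 S2] := Sv s t ms mt.
have [l l01 zl] : exists2 l : R, 0 <= l <= 1 & z = l * a + (1 - l) * 1.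
  by apply: between_convex; lra.
split.
  by have := convex_pt cS l01 Sa S1; congr (S (pt _ _ _)); rewrite ?zl; ring.
by have := convex_pt cS l01 Sa S2; congr (S (pt _ _ _)); rewrite ?zl; ring.
Qed.

Lemma half_hull (R : realType) (a : R) : 0 <= a < 1 ->
  half_solid a = convex_hull [set` half_vertices a].
Proof.
move=> a01; apply/seteqP; split.
  apply: half_sub_convex => //; [exact: convex_hull_convex|exact: sub_convex_hull].
apply: convex_hull_min; first exact: convex_polyhedron.
apply/half_vertices_sub => s t; rewrite !inE => /orP[]/eqP-> /orP[]/eqP->;
by split; apply/halfP; split; try split; lra.
Qed.

(** * The truncated cube and its two halves *)

Lemma truncated_cube_vertexP (R : realType) (x y z : R) :
  truncated_cube_vertices (pt x y z) <->
  [\/ [/\ `|x| = Num.sqrt 2 - 1, `|y| = 1 & `|z| = 1],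
      [/\ `|x| = 1, `|y| = Num.sqrt 2 - 1 & `|z| = 1] |
      [/\ `|x| = 1, `|y| = 1 & `|z| = Num.sqrt 2 - 1]].
Proof.
split=> [[i iP]|].
- have := (iP 0, iP 1, iP 2); rewrite !mxE /=.
  case: i {iP} => -[|[|[|//]]] i3 /= -[[x1 y1] z1].
  + by apply: Or31.
  + by apply: Or32.
  + by apply: Or33.
- by case=> -[x1 y1 z1]; [exists 0|exists 1|exists 2];
  move=> -[[|[|[|//]]] j3]; rewrite mxE.
Qed.

Lemma sqrt2_bounds (R : realType) : 0 < Num.sqrt (2 : R) - 1 < 1.
Proof.
have s0 : 0 <= Num.sqrt (2 : R) by exact: sqrtr_ge0.
have s2 : Num.sqrt (2 : R) ^+ 2 = 2 by rewrite sqr_sqrtr // ler0n.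
by apply/andP; split; nra.
Qed.

(** Both sides equal the set [solid] of the inequalities on [|x|], [|y|], [|z|].
    The vertices [(+-1, +-1, 0)] created by the cut are midpoints of vertical
    edges of the truncated cube. *)
Lemma truncated_cube_halves (R : realType) :
  let a : R := Num.sqrt 2 - 1 in
  convex_hull (@truncated_cube_vertices R) = half_solid a `|` -%R @` half_solid a.
Proof.
move=> a; have /andP[a0 a1] := @sqrt2_bounds R; rewrite -/a in a0 a1.
set K := convex_hull _.
have signP (s : R) : s \in signs R -> `|s| = 1.
  by rewrite !inE => /orP[]/eqP->; rewrite ?normrN normr1.
have cK : @convex_set R 'rV[R]_3 K by exact: convex_hull_convex.
have Kv x y z : truncated_cube_vertices (pt x y z) -> K (pt x y z).
  exact: sub_convex_hull.
have na : `|a| = a by rewrite ger0_norm // ltW.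
have halfK : half_solid a `<=` K.
  apply: half_sub_convex => //; first by rewrite a1 ltW.
  apply/half_vertices_sub => s t /signP s1 /signP t1.
  have Ka b : `|b| = a -> K (pt s t b).
    by move=> ba; apply: Kv; apply/truncated_cube_vertexP; apply: Or33.
  split.
  + by apply: (convex_z cK (u := - a) (v := a)); [lra|apply: Ka; rewrite normrN|exact: Ka].
  + exact: Ka.
  + by apply: Kv; apply/truncated_cube_vertexP; apply: Or32; rewrite normrM t1 na mul1r normr1.
  + by apply: Kv; apply/truncated_cube_vertexP; apply: Or31; rewrite normrM s1 na mul1r normr1.
have Kopp x : K x -> K (- x).
  have /convex_setP cK' := cK.
  have : @convex_set R 'rV[R]_3 [set x | K (- x)].
    apply/convex_setP => u v l l01 Ku Kv' /=.
    by rewrite opprD -!scalerN; apply: cK'.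
  move/convex_hull_min; apply=> v; have [u [w [r ->]]] := pt_surj v => Vv /=.
  rewrite -scaleN1r ptZ !mulN1r; apply: Kv; apply/truncated_cube_vertexP.
  by rewrite !normrN; exact/truncated_cube_vertexP.
apply/seteqP; split; last first.
  by move=> x [/halfK //|[y /halfK Ky <-]]; exact: Kopp.
pose solid := [set v : 'rV[R]_3 | (forall j, `|v 0 j| <= 1) /\
  `|v 0 0| + `|v 0 1| + `|v 0 2| <= 2 + a].
have solidP x y z : solid (pt x y z) <->
    [/\ `|x| <= 1, `|y| <= 1, `|z| <= 1 & `|x| + `|y| + `|z| <= 2 + a].
  rewrite /solid /= !mxE /=; split=> [[H ->]|[x1 y1 z1 ->]].
    by have := (H 0, H 1, H 2); rewrite !mxE /= => -[[]].
  by split=> // -[[|[|[|//]]] j3]; rewrite mxE.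
have Ksolid : K `<=` solid.
  apply: convex_hull_min => [|v].
    apply/convex_setP => u v l l01.
    have [x [y [z ->]]] := pt_surj u; have [x' [y' [z' ->]]] := pt_surj v.
    move=> /solidP[x1 y1 z1 xyz] /solidP[x1' y1' z1' xyz'].
    have /andP[l0 l1] := l01; have l1' : 0 <= 1 - l by rewrite subr_ge0.
    have conv_norm (p q : R) :
        `|l * p + (1 - l) * q| <= l * `|p| + (1 - l) * `|q|.
      by rewrite (le_trans (ler_normD _ _)) // !normrM (ger0_norm l0) (ger0_norm l1').
    rewrite !ptZ ptD; apply/solidP.
    have := (conv_norm x x', (conv_norm y y', conv_norm z z')) => -[hx [hy hz]].
    by split; nra.
  have [x [y [z ->]]] := pt_surj v; move/truncated_cube_vertexP.
  by rewrite -/a => -[] [hx hy hz]; apply/solidP; rewrite hx hy hz; split; lra.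
apply: subset_trans Ksolid _ => v; have [x [y [z ->]]] := pt_surj v.
move=> /solidP[]; rewrite !ler_norml => x1 y1 z1.
have := (ler_norm x, ler_norm (- x), (ler_norm y, ler_norm (- y)),
  (ler_norm z, ler_norm (- z))).
rewrite !normrN => -[[[hx hx'] [hy hy']] [hz hz']] h.
have [z0|z0] := leP 0 z; [left|right].
  by apply/halfP; split; [lra|lra|lra|split; lra|split; lra].
exists (pt (- x) (- y) (- z)); last by rewrite -scaleN1r ptZ !mulN1r !opprK.
by apply/halfP; split; [lra|lra|lra|split; lra|split; lra].
Qed.

(** * The rotation *)

(** The eighth turn about the third axis, which carries the horizontal
    diagonals of the cube to the first two coordinate axes. *)
Definition eighth_turn (R : realType) : 'M[R]_3 :=
  let w : R := (Num.sqrt 2)^-1 in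
  \matrix_(i < 3) [:: pt w w 0; pt (- w) w 0; pt 0 0 1]`_i.

Lemma pt_eighth_turn (R : realType) (x y z : R) :
  let w : R := (Num.sqrt 2)^-1 in
  pt x y z *m eighth_turn R = pt (w * (x - y)) (w * (x + y)) z.
Proof.
move=> w; apply/rowP => -[[|[|[|//]]] j3];
rewrite mxE !big_ord_recr big_ord0 /= !mxE /= -/w ?mxE /=; ring.
Qed.

Lemma eighth_turn_orthogonal (R : realType) : orthogonal_mx (eighth_turn R).
Proof.
set w := (Num.sqrt 2)^-1 : R.
have w2 : w * w = 2^-1.
  by rewrite -invfM -expr2 sqr_sqrtr // ler0n.
apply/matrixP => i j; rewrite mxE !big_ord_recr big_ord0 /= !mxE.
case: i => -[|[|[|//]]] i3; case: j => -[|[|[|//]]] j3; rewrite /= !mxE /= -/w; lra.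
Qed.

Lemma eighth_turn_scale_unit (R : realType) (C : R) :
  C != 0 -> C *: eighth_turn R \in unitmx.
Proof.
move=> C0; rewrite unitmxZ ?unitfE //.
by have /mulmx1_unit[] := @eighth_turn_orthogonal R.
Qed.

Lemma delta_pt (R : realType) :
  [/\ delta_mx 0 0 = pt 1 0 0 :> 'rV[R]_3, delta_mx 0 1 = pt 0 1 0 :> 'rV[R]_3
    & delta_mx 0 2 = pt 0 0 1 :> 'rV[R]_3].
Proof. by split; apply/rowP => -[[|[|[|//]]] j3]; rewrite !mxE. Qed.

Lemma half_facetP (R : realType) (a x y z : R) (k : 'I_10) :
  half_solid a (pt x y z) -> pt x y z ** half_normal R k = half_bound a k ->
  facet (@half_normal R) (half_bound a) k (pt x y z).
Proof. by []. Qed.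

(** * The boundary of the rotated half *)

Section HalfBoundary.
Variables (R : realType) (a C : R) (t : 'rV[R]_3).
Hypothesis C0 : C != 0.

Let g (x : 'rV[R]_3) := x *m (C *: eighth_turn R) + t.
Let F := facet (@half_normal R) (half_bound a).
Let J p q := joined (boundary (g @` half_solid a)) (g p) (g q).

(** The three allowed directions [(1, 1, 0)], [(1, -1, 0)] and [(0, 0, 1)] are
    those which the eighth turn makes parallel to an axis. *)
Lemma joined_half k x y z x' y' z' :
  F k (pt x y z) -> F k (pt x' y' z') ->
  [\/ x' - x = y' - y /\ z' = z, x' - x = y - y' /\ z' = z
    | x' = x /\ y' = y] ->
  J (pt x y z) (pt x' y' z').
Proof.
set w : R := (Num.sqrt 2)^-1; have [e0 e1 e2] := @delta_pt R.
have step i e := @joined_affine_facet R 3 'I_10 (C *: eighth_turn R) t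
  _ (half_bound a) k (pt x y z) (pt x' y' z') i e (eighth_turn_scale_unit C0)
  (@half_normal_neq0 R).
have diffE : (pt x' y' z' - pt x y z) *m (C *: eighth_turn R) =
    C *: pt (w * ((x' - x) - (y' - y))) (w * ((x' - x) + (y' - y))) (z' - z).
  by rewrite -scalemxAr -(scaleN1r (pt x y z)) [-1 *: _]ptZ ptD pt_eighth_turn !mulN1r.
rewrite /J /g /half_solid => Fp Fq [[xy zz]|[xy zz]|[xx yy]].
- apply: (step 1 (C * (w * (2 * (x' - x)))) Fp Fq).
  by rewrite diffE e1 !ptZ xy zz; congr pt; ring.
- apply: (step 0 (C * (w * (2 * (x' - x)))) Fp Fq).
  by rewrite diffE e0 !ptZ xy zz; congr pt; ring.
- apply: (step 2 (C * (z' - z)) Fp Fq).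
  by rewrite diffE e2 !ptZ xx yy; congr pt; ring.
Qed.

Ltac in_facet := apply: half_facetP;
  [apply/halfP; split; [lra|lra|lra|split; lra|split; lra]
  |rewrite pt_dot /half_bound /=; lra].

(* One edge in facet [k] from a point known to be there to [q], in the [d]-th
   of the three directions of [joined_half]. *)
Ltac edge_to k q d := apply: (@joined_trans _ _ _ _ (g q));
  [apply: (@joined_half k); [assumption|in_facet|apply: d; split; lra]|].

Lemma joined_bottom x y z :
  F (ord10 0) (pt x y z) -> J (pt x y z) (pt 0 0 0).
Proof.
move=> Fp; case: (Fp) => /halfP[z1 x1 y1 [h6 h7] [h8 h9]].
rewrite /= pt_dot /half_bound /= => zE.
edge_to (ord10 0) (pt ((x + y) / 2) ((x + y) / 2) z) Or32.
by apply: (@joined_half (ord10 0)); [in_facet|in_facet|apply: Or31; split; lra].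
Qed.

Lemma joined_side (k : 'I_10) x y z : (1 < k < 6)%N ->
  F k (pt x y z) -> J (pt x y z) (pt 0 0 0).
Proof.
move=> k25 Fp; case: (Fp) => /halfP[z1 x1 y1 [h6 h7] [h8 h9]] kE.
have bottom : F (ord10 0) (pt x y 0) by in_facet.
apply: joined_trans (joined_bottom bottom).
move: k25 kE Fp; elim/ord10_ind: k => // _; rewrite /= pt_dot /half_bound /= => kE Fp.
- by apply: (@joined_half (ord10 2)); [|in_facet|apply: Or33].
- by apply: (@joined_half (ord10 3)); [|in_facet|apply: Or33].
- by apply: (@joined_half (ord10 4)); [|in_facet|apply: Or33].
- by apply: (@joined_half (ord10 5)); [|in_facet|apply: Or33].
Qed.

(** The intermediate points: on the top octagon, [(1/2, 1/2, 1)] is chosen on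
    the diagonal [x = y] so that the other diagonal direction leads from it to
    the edge [x = 1]; on a triangle, the horizontal direction of the face leads
    to its edge on a half octagon [x = +-1]. *)
Lemma joined_origin k x y z :
  0 < a < 1 -> F k (pt x y z) -> J (pt x y z) (pt 0 0 0).
Proof.
move=> a01; have [k25|kN] := boolP (1 < k < 6)%N; first exact: joined_side.
move=> Fp; case: (Fp) => /halfP[z1 x1 y1 [h6 h7] [h8 h9]].
move: kN Fp; elim/ord10_ind: k => // _ Fp; rewrite /= pt_dot /half_bound /= => kE.
- exact: joined_bottom.
- have Fm : F (ord10 1) (pt ((x + y) / 2) ((x + y) / 2) 1) by in_facet.
  have Fh : F (ord10 1) (pt 2^-1 2^-1 1) by in_facet.
  edge_to (ord10 1) (pt ((x + y) / 2) ((x + y) / 2) 1) Or32.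
  edge_to (ord10 1) (pt (2^-1 : R) 2^-1 1) Or31.
  edge_to (ord10 1) (pt (1 : R) 0 1) Or32.
  by apply: (@joined_side (ord10 2)) => //; in_facet.
- edge_to (ord10 6) (pt 1 (1 + a - z) z) Or32.
  by apply: (@joined_side (ord10 2)) => //; in_facet.
- edge_to (ord10 7) (pt 1 (- (1 + a - z)) z) Or31.
  by apply: (@joined_side (ord10 2)) => //; in_facet.
- edge_to (ord10 8) (pt (-1) (1 + a - z) z) Or31.
  by apply: (@joined_side (ord10 3)) => //; in_facet.
- edge_to (ord10 9) (pt (-1) (- (1 + a - z)) z) Or32.
  by apply: (@joined_side (ord10 3)) => //; in_facet.
Qed.

Lemma half_boundary_connected :
  0 < a < 1 -> orthogonally_connected (boundary (g @` half_solid a)).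
Proof.
move=> a01; have Cu := eighth_turn_scale_unit C0.
apply: (@joined_to_connected _ _ _ (g (pt 0 0 0))).
rewrite {1}polyhedron_affine // boundary_polyhedron => [|k]; last first.
  by have [] := facet_witness_affine t Cu (half_facet_witness a01) k.
move=> v [k _]; rewrite -facet_affine //; case=> p + <-.
by have [x [y [z ->]]] := pt_surj p; exact: joined_origin.
Qed.

Lemma half_decahedron : 0 < a < 1 -> decahedron (g @` half_solid a).
Proof.
move=> a01; have Cu := eighth_turn_scale_unit C0; have /andP[a0 a1] := a01.
split.
  exists (g @` [set` half_vertices a]); first exact/finite_image/finite_seq.
  by rewrite half_hull ?a1 ?ltW // convex_hull_affine.
rewrite /half_solid polyhedron_affine //.
exact: card_faces2_polyhedron (facet_witness_affine t Cu (half_facet_witness a01)).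
Qed.

End HalfBoundary.

(** * The decomposition *)

Lemma half_below (R : realType) (a : R) : half_solid a `<=`
  [set v | v ** half_normal R (ord10 0) <= 0].
Proof. by move=> v /(_ (ord10 0)). Qed.

(** The two halves lie on opposite sides of the image of the cutting plane;
    being interior to a half excludes lying on that plane. *)
Lemma halves_disjoint_interiors (R : realType) (a C : R) (t : 'rV[R]_3)
    (x : 'rV[R]_3) : C != 0 ->
  interior ((fun x => x *m (C *: eighth_turn R) + t) @` half_solid a) x ->
  interior ((fun x => x *m (- C *: eighth_turn R) + t) @` half_solid a) x ->
  False.
Proof.
move=> C0; have Cu := eighth_turn_scale_unit C0.
set c := invmx (C *: eighth_turn R) *m half_normal R (ord10 0) => int1 int2.
have c0 : c != 0.
  apply: contraNneq (half_normal_neq0 R (ord10 0)) => c0.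
  by rewrite -[half_normal _ _](mulKVmx Cu) -/c c0 mulmx0.
have below : x ** c < t ** c.
  apply: (interior_dot_lt c0 _ int1) => _ [u /half_below /= uP <-].
  by rewrite dotD -mulmxA mulKVmx // gerDr.
have above : x ** - c < t ** - c.
  apply: interior_dot_lt int2; first by rewrite oppr_eq0.
  move=> _ [u /half_below /= uP <-].
  rewrite dotD scaleNr [u *m _]mulmxN mulNmx mulmxN opprK -mulmxA mulKVmx //.
  by rewrite gerDr.
have dotN v : v ** - c = - (v ** c) by rewrite mulmxN mxE.
by move: above; rewrite !dotN ltrN2 ltNge (ltW below).
Qed.

Lemma det_orthogonal_mx (R : realType) (n : nat) (A : 'M[R]_n) :
  orthogonal_mx A -> \det A * \det A = 1.
Proof. by move=> AA; rewrite -{2}det_tr -det_mulmx AA det1. Qed.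

Theorem theorem5p7 (R : realType) (T : set 'rV[R]_3)
    (hT : is_truncated_cube T) :
  exists2 rho : 'rV[R]_3 -> 'rV[R]_3, is_rotation rho &
    exists2 P : 'I_2 -> set 'rV[R]_3, decomposed (rho @` T) P &
      forall i : 'I_2, decahedron (P i) /\ orthogonally_connected (boundary (P i)).
Proof.
have a01 := sqrt2_bounds R; case: hT => f [c [A [t [c0 AA fE]]]] ->.
set a := Num.sqrt (2 : R) - 1 in a01.
set E := eighth_turn R; have EE : orthogonal_mx E := eighth_turn_orthogonal R.
(* The sign [s] also allows for the case where the similarity reverses
   orientation. *)
pose s := \det A * \det E.
have s2 : s * s = 1.
  by rewrite mulrACA !det_orthogonal_mx // mulr1.
pose B := s *: (A^T *m E); pose C := c * s.
have C0 : C != 0.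
  apply: mulf_neq0; first exact: lt0r_neq0.
  by apply: contra_eq_neq s2 => ->; rewrite mul0r eq_sym oner_eq0.
pose g e x := x *m (e *: E) + t *m B.
pose P (i : 'I_2) := g (if i == 0 then C else - C) @` half_solid a.
exists (fun x => x *m B).
  exists B; split=> //.
  - rewrite /orthogonal_mx linearZ /= -scalemxAl -scalemxAr scalerA s2 scale1r.
    rewrite trmx_mul trmxK mulmxA -[A^T *m E *m E^T]mulmxA EE mulmx1.
    exact: mulmx1C AA.
  - rewrite detZ det_mulmx det_tr -/s exprS expr2 s2 mulr1.
    exact: s2.
(* The lower half is the image of the upper one under [-%R], which is absorbed
   in the sign of the scaling factor. *)
have gN x : g C (- x) = g (- C) x by rewrite /g scaleNr mulNmx mulmxN.
have rho_f x : f x *m B = g C x.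
  rewrite fE /g mulmxDl -scalemxAl -scalemxAr -mulmxA mulmxA.
  rewrite -[x *m A *m _]mulmxA [A *m (A^T *m E)]mulmxA AA mul1mx.
  by rewrite scalerA scalemxAr.
have hP i : decahedron (P i) /\ orthogonally_connected (boundary (P i)).
  have Ci0 : (if i == 0 then C else - C) != 0 by case: ifP; rewrite ?oppr_eq0.
  split; [exact: half_decahedron|exact: half_boundary_connected].
exists P => //; split.
- by move=> i; case: (hP i) => -[].
- rewrite truncated_cube_halves -/a; apply/seteqP; split.
  + move=> _ [_ [x + <-] <-]; rewrite rho_f => -[xH|[y yH <-]].
      by exists 0 => //; exists x.
    by exists 1 => //; exists y => //; rewrite gN.
  + move=> _ [i _ [x xH <-]]; rewrite /=; case: ifP => _.
      by exists (f x) => //; exists x => //; left.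
    exists (f (- x)); last by rewrite rho_f gN.
    by exists (- x) => //; right; exists x.
- have disjoint x : interior (P 0) x -> interior (P 1) x -> False.
    exact: halves_disjoint_interiors.
  move=> [[|[|//]] i2] [[|[|//]] j2] _ _ [x [xi xj]]; try exact/val_inj.
  + by case: (disjoint x).
  + by case: (disjoint x).
Qed.
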